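(* Consider the pricing problem with procurement cost $c>0$, i.e. $\mathcal{Z}=(c,\infty)$ and $r(z)=z-c$. Suppose that the mean demand curve $y(z)$ is non-increasing and linear (affine) in $z$ on $\mathcal{Z}$, that the confounding error $E(z)$ is non-increasing in $z$, and that $|E(z)|/y_0\le\gamma$ for all $z\in\mathcal{Z}$, where $\gamma\le 1$. Then $$1-4\gamma+4\gamma^{3/2}-\gamma^2\;\le\;\frac{R(\tilde z)}{R(z^\star)}\;\le\;1 .$$
   Context: $Z$ is a $\mathcal{Z}$-valued random variable (the historical price), $Y(z)$, $z\in\mathcal{Z}$, are real random variables (the random demand curve), and $Y=Y(Z)$ is the observed demand. Define $y(z)=\mathbb{E}[Y(z)]$ (mean demand curve), $\tilde y(z)=\mathbb{E}[Y\mid Z=z]$ (viewed as a fixed function on $\mathcal{Z}$), $R(z)=r(z)y(z)$ and $\tilde R(z)=r(z)\tilde y(z)$. Let $\epsilon(z)=Y(z)-y(z)$ and $\epsilon=\epsilon(Z)=Y-y(Z)$. The confounding error is $E(z)=\tilde y(z)-y(z)=\mathbb{E}[\epsilon\mid Z=z]$. The size of the market is $y_0=\sup_{z\in\mathcal{Z}}y(z)$. The optimizers $z^\star\in\arg\max_{z\in\mathcal{Z}}R(z)$ and $\tilde z\in\arg\max_{z\in\mathcal{Z}}\tilde R(z)$ are assumed to exist; $\tilde z$ is any such maximizer. *)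

(* Defs.v *)
From HB Require Import structures.
From mathcomp Require Import all_boot all_order all_algebra.
From mathcomp Require Import all_classical all_reals all_analysis.

Set Implicit Arguments.
Unset Strict Implicit.
Unset Printing Implicit Defensive.

Import Order.TTheory GRing.Theory Num.Theory.

Local Open Scope classical_set_scope.
Local Open Scope ring_scope.

(* Price sets are subsets D of R, and curves on D are total functions R -> R
   of which only the values on D are meaningful. *)

Section Optimization.
Context {R : realType}.

Definition is_argmax (D : set R) (f : R -> R) (z : R) : Prop :=
  D z /\ forall w, D w -> f w <= f z.

Definition nonincreasing_on (D : set R) (f : R -> R) : Prop :=
  forall z w, D z -> D w -> z <= w -> f w <= f z.

Definition affine_on (D : set R) (f : R -> R) : Prop :=
  exists a b : R, forall z, D z -> f z = a + b * z.

Definition revenue (r y : R -> R) (z : R) : R := r z * y z.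

Definition market_size (D : set R) (y : R -> R) : R := sup (y @` D).

End Optimization.

Section Demand.
Context {d : measure_display} {T : measurableType d} {R : realType}
        {P : probability T R}.

Definition observed_demand (Z : {RV P >-> R}) (Y : R -> T -> R) (w : T) : R :=
  Y (Z w) w.

Definition mean_demand (Y : R -> T -> R) (z : R) : R := fine 'E_P[Y z].

(* g is a version on D of z |-> E[X | Z = z], where Z takes its values in D. A
   version is determined only up to null sets of the law of Z; g is one fixed
   choice, with a value at every point of D. *)
Definition is_cond_expectation (D : set R) (Z : {RV P >-> R}) (X : T -> R)
    (g : R -> R) : Prop :=
  [/\ measurable_fun D g,
      (fun w => g (Z w)) \in Lfun P 1%E &
      forall B : set R, measurable B ->
        (\int[P]_(w in Z @^-1` B) (X w)%:E =
         \int[P]_(w in Z @^-1` B) (g (Z w))%:E)%E].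

(* Expectations exist: each Y z with z in D, and the observed demand, are
   integrable random variables (Lfun P 1 includes measurability). *)
Definition pricing_model (D : set R) (Z : {RV P >-> R}) (Y : R -> T -> R)
    : Prop :=
  [/\ forall w, D (Z w),
      forall z, D z -> Y z \in Lfun P 1%E &
      observed_demand Z Y \in Lfun P 1%E].

Definition confounding_error (Y : R -> T -> R) (ytilde : R -> R) (z : R) : R :=
  ytilde z - mean_demand Y z.

End Demand.

Arguments mean_demand {d T R} P Y z.
Arguments confounding_error {d T R} P Y ytilde z.

(* Main.v *)
Require Import Defs.
From HB Require Import structures.
From mathcomp Require Import all_boot all_order all_algebra.
From mathcomp Require Import all_classical all_reals all_analysis.
From mathcomp Require Import ring lra.

Import Order.TTheory GRing.Theory Num.Theory.

Local Open Scope classical_set_scope.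
Local Open Scope ring_scope.

(** Measure the price by its margin [x = z - c > 0], so that the mean demand is
    [A - B * x] with [A] its supremum and [R] is the parabola [x * (A - B * x)].
    The existence of a maximizer forces [A > 0] and [B > 0]
    ([linear_monopoly]), so the optimal revenue is [A ^+ 2 / (4 * B)] and the
    ratio at a margin [t] is [1 - ((A - 2 * B * t) / A) ^+ 2].  With
    [s = sqrt gamma] the claimed bound is [1 - (2 * s - s ^+ 2) ^+ 2], so it
    amounts to [`|A - 2 * B * t| <= A * (2 * s - s ^+ 2)] for the maximizer [t]
    of the confounded revenue [x * (A - B * x + E x)].

    The margin [t] is not too large: since [E] is non-increasing, lowering the
    margin from [t] can only gain from the error, so [t] is also optimal to its
    left for the parabola with the error frozen at [E t], whence
    [2 * B * t <= A + E t <= A * (1 + gamma)] ([confounded_margin_le]).  This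
    suffices because [gamma <= s], that is, [gamma <= 2 * s - s ^+ 2].

    The margin [t] is not too small: the confounded revenue at [t] is at most
    [t * (A * (1 + gamma) - B * t)], and at least the maximum of the
    pessimistic parabola [w * (A * (1 - gamma) - B * w)].  Hence [t] lies above
    the smaller root of a quadratic whose discriminant involves
    [(1 + gamma) ^+ 2 - (1 - gamma) ^+ 2 = (2 * s) ^+ 2], and
    [2 * B * t >= A * (1 - s) ^+ 2] ([confounded_margin_ge]). *)

(** * Linear demand without confounding *)

Section Parabola.
Context {R : realFieldType}.
Implicit Types A B x t : R.

Lemma parabola_complete_square A B x :
  4 * B * (x * (A - B * x)) = A ^+ 2 - (A - 2 * B * x) ^+ 2.
Proof. ring. Qed.

(** A positive point that beats everything to its left cannot lie beyond the
    vertex. *)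
Lemma left_argmax_le_vertex A B t : 0 < B -> 0 < t ->
  (forall w, 0 < w -> w <= t -> w * (A - B * w) <= t * (A - B * t)) ->
  2 * B * t <= A.
Proof.
move=> B0 t0 tmax; rewrite leNgt; apply/negP => At.
have vt : A / (2 * B) < t by rewrite ltr_pdivrMr; nra.
(* The vertex itself may be nonpositive, so compare with a positive point
   between the vertex and [t]. *)
pose w := Num.max (A / (2 * B)) (t / 2).
have w0 : 0 < w by rewrite /w lt_max; apply/orP; right; lra.
have wt : w < t by rewrite /w gt_max vt /=; lra.
have vw : A <= w * (2 * B).
  by rewrite -ler_pdivrMr ?le_max ?lexx //; lra.
have := tmax w w0 (ltW wt).
have -> : t * (A - B * t) = w * (A - B * w) + (t - w) * (A - B * (t + w)).
  by ring.
nra.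
Qed.

(** Halving the optimal margin cannot raise the revenue, so [A] is nonnegative;
    doubling it cannot either, so the demand has a slope. *)
Lemma linear_monopoly A B x : A != 0 -> 0 <= B -> 0 < x ->
  (forall w, 0 < w -> w * (A - B * w) <= x * (A - B * x)) ->
  [/\ 0 < A, 0 < B & x * (A - B * x) = A ^+ 2 / (4 * B)].
Proof.
move=> An0 B0 x0 xmax.
have A0 : 0 < A.
  rewrite lt_neqAle eq_sym An0 /= leNgt; apply/negP => An.
  have x20 : 0 < x / 2 by lra.
  have := xmax _ x20; have := mulr_ge0 (mulr_ge0 B0 (ltW x0)) (ltW x0).
  nra.
have Bpos : 0 < B.
  rewrite lt_neqAle B0 andbT; apply/eqP => B_eq0.
  have x20 : 0 < 2 * x by lra.
  by have := xmax _ x20; rewrite -B_eq0; nra.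
split=> //.
have v0 : 0 < A / (2 * B) by rewrite divr_gt0 ?mulr_gt0.
have B4 : 0 < 4 * B by lra.
apply: (mulfI (lt0r_neq0 B4)).
rewrite (mulrC _ (A ^+ 2 / _)) divfK ?lt0r_neq0//.
apply/eqP; rewrite eq_le; apply/andP; split.
  by rewrite parabola_complete_square gerBl sqr_ge0.
have := xmax _ v0; rewrite -(ler_pM2l B4).
rewrite parabola_complete_square.
have -> : 2 * B * (A / (2 * B)) = A by rewrite mulrC divfK //; lra.
by rewrite subrr expr0n subr0.
Qed.

End Parabola.

(** * The margin chosen under a monotone bounded error *)

Section Confounding.
Context {R : realFieldType} {A B g t : R} {e : R -> R}.
Hypotheses (A0 : 0 < A) (B0 : 0 < B) (t0 : 0 < t).
Hypothesis e_le : forall x, 0 < x -> `|e x| <= g * A.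
Hypothesis tmax : forall w, 0 < w ->
  w * (A - B * w + e w) <= t * (A - B * t + e t).

Lemma confounded_margin_le :
  (forall x w, 0 < x -> x <= w -> e w <= e x) -> 2 * B * t <= A * (1 + g).
Proof.
move=> e_noninc.
have : 2 * B * t <= A + e t.
  apply: left_argmax_le_vertex => // w w0 wt.
  have := tmax w w0; have := e_noninc _ _ w0 wt.
  nra.
by have := e_le _ t0; rewrite ler_norml => /andP[_]; lra.
Qed.

(** Comparing with the vertex of [w * (A * (1 - s ^+ 2) - B * w)] gives
    [(A * (1 + s ^+ 2) - 2 * B * t) ^+ 2 <= (2 * A * s) ^+ 2]. *)
Lemma confounded_margin_ge (s : R) : 0 <= s -> s <= 1 -> g = s ^+ 2 ->
  A * (1 - s) ^+ 2 <= 2 * B * t.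
Proof.
move=> s0; rewrite le_eqVlt => /orP[/eqP-> _|s1 gs].
  (* For [s = 1] the comparison margin degenerates to 0, as does the bound. *)
  by rewrite subrr expr0n mulr0 !mulr_ge0// ltW.
pose w := A * (1 - s ^+ 2) / (2 * B).
have s21 : 0 < 1 - s ^+ 2 by rewrite subr_gt0 expr_lt1.
have w0 : 0 < w by rewrite divr_gt0 ?mulr_gt0.
have wE : 2 * B * w = A * (1 - s ^+ 2).
  by rewrite mulrC divfK // lt0r_neq0// mulr_gt0.
have pess : w * (A * (1 - s ^+ 2) - B * w) <= w * (A - B * w + e w).
  rewrite ler_pM2l//; have := e_le _ w0.
  by rewrite gs ler_norml => /andP[]; lra.
have opt : t * (A - B * t + e t) <= t * (A * (1 + s ^+ 2) - B * t).
  rewrite ler_pM2l//; have := e_le _ t0.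
  by rewrite gs ler_norml => /andP[_]; lra.
have B4 : 0 < 4 * B by rewrite mulr_gt0.
have := le_trans pess (le_trans (tmax _ w0) opt).
rewrite -(ler_pM2l B4) !parabola_complete_square wE subrr expr0n subr0 => h.
have : (A * (1 + s ^+ 2) - 2 * B * t) ^+ 2 <= (2 * A * s) ^+ 2.
  have -> : (2 * A * s) ^+ 2 =
    (A * (1 + s ^+ 2)) ^+ 2 - (A * (1 - s ^+ 2)) ^+ 2 by ring.
  by lra.
have As0 : 0 <= 2 * A * s by rewrite mulr_ge0// mulr_ge0// ltW.
rewrite -[leLHS]real_normK ?num_real// ler_pXn2r ?nnegrE ?normr_ge0// => hn.
have := le_trans (ler_norm _) hn.
have -> : A * (1 - s) ^+ 2 = A * (1 + s ^+ 2) - 2 * A * s by ring.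
by lra.
Qed.

End Confounding.

(** * The revenue ratio *)

Lemma powR32_sqrt (R : realType) (g : R) : 0 <= g ->
  g `^ (3 / 2) = Num.sqrt g ^+ 3.
Proof.
move=> g0; rewrite mulrC powRrM powR12_sqrt//.
by rewrite powR_mulrn ?sqrtr_ge0.
Qed.

(** The supremum is the limit at [c], which is not an admissible price: it is
    attained only by a constant curve. *)
Lemma affine_market_size (R : realType) (c a b : R) (y : R -> R) :
  b <= 0 -> (forall z, c < z -> y z = a + b * z) ->
  market_size [set z | c < z] y = a + b * c.
Proof.
move=> b0 yE; rewrite /market_size.
have ub : ubound (y @` [set z | c < z]) (a + b * c).
  by move=> _ [z /= cz <-]; rewrite yE//; nra.
apply/eqP; rewrite eq_le; apply/andP; split.
  by apply: ge_sup => //; exists (y (c + 1)), (c + 1) => //=; lra.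
apply/ler_addgt0Pr => k k0.
(* Any price [c + x] with [- b * x <= k] comes within [k] of the supremum. *)
have b1 : 0 < 1 - b by lra.
pose x := k / (1 - b).
have x0 : 0 < x by rewrite divr_gt0.
have xE : x * (1 - b) = k by rewrite divfK ?lt0r_neq0.
have cx : c < c + x by lra.
have : y (c + x) <= sup (y @` [set z | c < z]).
  by apply: ub_le_sup; [exists (a + b * c) | exists (c + x)].
by rewrite yE//; nra.
Qed.

Lemma le_unconfounded_ratio (R : realFieldType) (A B s t : R) :
  0 < A -> 0 < B -> 0 <= s -> s <= 1 ->
  A * (1 - s) ^+ 2 <= 2 * B * t -> 2 * B * t <= A * (1 + s ^+ 2) ->
  1 - (2 * s - s ^+ 2) ^+ 2 <= t * (A - B * t) / (A ^+ 2 / (4 * B)).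
Proof.
move=> A0 B0 s0 s1 lo hi.
have B4 : 0 < 4 * B by lra.
rewrite invf_div mulrA ler_pdivlMr ?exprn_gt0//.
rewrite (mulrC _ (4 * B)) parabola_complete_square.
rewrite mulrBl mul1r -exprMn lerD2l lerN2.
have k0 : 0 <= (2 * s - s ^+ 2) * A.
  by apply: mulr_ge0; [nra | exact: ltW].
rewrite -[leLHS]real_normK ?num_real// ler_pXn2r ?nnegrE ?normr_ge0// ler_norml.
have sA : s ^+ 2 * A <= s * A by rewrite ler_pM2r//; nra.
by apply/andP; split; lra.
Qed.

Theorem theorem4 (d : measure_display) (T : measurableType d) (R : realType)
    (P : probability T R) (c gamma : R)
    (Z : {RV P >-> R}) (Y : R -> T -> R) (ytilde : R -> R) (zstar ztilde : R) :
  let D : set R := [set z | c < z] in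
  let r : R -> R := fun z => z - c in
  let y : R -> R := mean_demand P Y in
  let y0 : R := market_size D y in
  let E : R -> R := confounding_error P Y ytilde in
  0 < c ->
  pricing_model D Z Y ->
  is_cond_expectation D Z (observed_demand Z Y) ytilde ->
  is_argmax D (revenue r y) zstar ->
  is_argmax D (revenue r ytilde) ztilde ->
  nonincreasing_on D y ->
  affine_on D y ->
  nonincreasing_on D E ->
  y0 != 0 ->
  (forall z, D z -> `|E z| / y0 <= gamma) ->
  gamma <= 1 ->
  1 - 4 * gamma + 4 * gamma `^ (3 / 2) - gamma ^+ 2
    <= revenue r y ztilde / revenue r y zstar <= 1.
Proof.
move=> D r y y0 E _ _ _ [zsD zs_max] [ztD zt_max] y_noninc [a [b yE]] E_noninc.
move=> y0n0 E_le gamma1.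
have b0 : b <= 0.
  have c1 : D (c + 1) by rewrite /D /=; lra.
  have c2 : D (c + 2) by rewrite /D /=; lra.
  have c12 : c + 1 <= c + 2 by lra.
  by have := y_noninc _ _ c1 c2 c12; rewrite !yE//; lra.
pose B := - b; pose A := a + b * c.
have y0E : y0 = A by exact: affine_market_size.
have cD x : 0 < x -> D (c + x) by rewrite /D /=; lra.
have RE z : D z -> revenue r y z = (z - c) * (A - B * (z - c)).
  by move=> zD; rewrite /revenue yE// /r /A /B; ring.
have zs0 : 0 < zstar - c by rewrite subr_gt0.
have zt0 : 0 < ztilde - c by rewrite subr_gt0.
have [A0 B0 Rstar] : [/\ 0 < A, 0 < B & (zstar - c) * (A - B * (zstar - c)) =
    A ^+ 2 / (4 * B)].
  apply: linear_monopoly => //; first by rewrite -y0E.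
    by rewrite oppr_ge0.
  move=> w w0; have := zs_max _ (cD _ w0).
  by rewrite !RE ?(addrC c) ?addrK// -(addrC c); exact: cD.
have Rstar0 : 0 < revenue r y zstar.
  by rewrite RE// Rstar divr_gt0 ?exprn_gt0 ?mulr_gt0.
apply/andP; split; last by rewrite ler_pdivrMr// mul1r zs_max.
have gamma0 : 0 <= gamma.
  by apply: le_trans (E_le _ ztD); rewrite y0E divr_ge0 ?normr_ge0 ?ltW.
pose s := Num.sqrt gamma.
have s0 : 0 <= s by exact: sqrtr_ge0.
have sE : gamma = s ^+ 2 by rewrite sqr_sqrtr.
have s1 : s <= 1 by rewrite -sqrtr1 ler_wsqrtr.
pose e x := E (c + x).
have e_le x : 0 < x -> `|e x| <= gamma * A.
  by move=> x0; have := E_le _ (cD _ x0); rewrite y0E ler_pdivrMr.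
have e_noninc x w : 0 < x -> x <= w -> e w <= e x.
  move=> x0 xw; apply: E_noninc; [exact: cD | |by rewrite lerD2l].
  by apply: cD; exact: lt_le_trans xw.
have RtE x : 0 < x -> revenue r ytilde (c + x) = x * (A - B * x + e x).
  move=> x0; rewrite /revenue /r /e /E /confounding_error -/y.
  by rewrite yE; [rewrite /A /B; ring | exact: cD].
have ctE : ztilde = c + (ztilde - c) by ring.
have tmax w : 0 < w -> w * (A - B * w + e w) <=
    (ztilde - c) * (A - B * (ztilde - c) + e (ztilde - c)).
  by move=> w0; rewrite -!RtE// -ctE; exact: zt_max (cD _ w0).
have lo := confounded_margin_ge A0 B0 zt0 e_le tmax s s0 s1 sE.
have hi := confounded_margin_le B0 zt0 e_le tmax e_noninc.
rewrite sE in hi.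
rewrite powR32_sqrt// -/s sE !RE// Rstar.
have -> : 1 - 4 * s ^+ 2 + 4 * s ^+ 3 - (s ^+ 2) ^+ 2 =
  1 - (2 * s - s ^+ 2) ^+ 2 by ring.
exact: le_unconfounded_ratio.
Qed.
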